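(* Let $q$ be a positive integer with $q \equiv 4 \pmod 6$. Then $M_q(q-1) \le q+2$.
   Context: Let $A=\{0,1,\dots,q-1\}$ be an alphabet with $q$ elements, regarded as an additive group (not necessarily cyclic). An $(n,q^k,d)$ code over $A$ is a subset $C\subseteq A^n$ (not necessarily linear) with $|C|=q^k$ and minimum Hamming distance $d$. It is a maximum distance separable (MDS) code if $d=n-k+1$. $M_q(k)$ denotes the maximum $n$ for which an $(n,q^k,n-k+1)$ MDS code over $A$ exists. *)

(* Defs.v *)
From mathcomp Require Import all_boot.

Set Implicit Arguments.
Unset Strict Implicit.
Unset Printing Implicit Defensive.

Section Codes.
Variable A : finType.

Definition hamming_dist (n : nat) (x y : {ffun 'I_n -> A}) : nat :=
  #|[set i | x i != y i]|.

(* Stated relationally: codes with fewer than two words have no minimum distance. *)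
Definition min_dist_is (n : nat) (C : {set {ffun 'I_n -> A}}) (d : nat) : Prop :=
  (exists x y, [/\ x \in C, y \in C, x != y & hamming_dist x y = d]) /\
  (forall x y, x \in C -> y \in C -> x != y -> d <= hamming_dist x y).

(* C is an (n, N, d) code over A. *)
Definition is_code (n N d : nat) (C : {set {ffun 'I_n -> A}}) : Prop :=
  #|C| = N /\ min_dist_is C d.

(* The truncated subtraction is harmless: |C| = |A|^k forces k <= n once
   |A| > 1. *)
Definition is_MDS (n k : nat) (C : {set {ffun 'I_n -> A}}) : Prop :=
  is_code (#|A| ^ k) (n - k + 1) C.

Definition MDS_exists (k n : nat) : Prop :=
  exists C : {set {ffun 'I_n -> A}}, is_MDS k C.

(* M_q(k) = m, where q = |A|: m is the maximum of the lengths n for which an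
   MDS code with |A|^k words exists. *)
Definition max_MDS_length_is (k m : nat) : Prop :=
  MDS_exists k m /\ (forall n, MDS_exists k n -> n <= m).

End Codes.

(* Main.v *)
Require Import Defs.
From mathcomp Require Import all_boot zify.

(** No MDS code with [q ^ (q - 1)] words has length [n >= q + 3], where
    [q = #|A|] is greater than [1] and [1] modulo [3]; this covers all [q] that
    are [4] modulo [6].  Suppose that [C] is such a code and write [k = q - 1].
    Two distinct words of [C] agree in fewer than [k] places ([MDS_eq_on]), and
    as [C] has [q ^ k] words, any [k] coordinates can be prescribed freely
    ([MDS_interpolation]).

    Fix a word [c] of [C], two coordinates [i] and [j], a set [U] of [q + 1]
    further coordinates, and a letter [a] other than [c i].  For a triple [T]
    inside [U], prescribe [x i = a] and [x = c] on [U :\: T]: these are [k]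
    coordinates, so there is such a word [x].  It already agrees with [c] in
    [k - 1] places, hence it differs from [c] on all of [T] and at [j].  Sort
    the triples by the letter [b = x j], which takes [q - 1] values.  Two
    triples in the same class cannot share two points, since their words would
    agree at [i], at [j] and on at least [q - 3] points of [U], so in at least
    [k] places, and would coincide ([triples_packing]).  By [packing_bound], a
    class has at most ['C(q + 1, 2) / 3] triples, while the ['C(q + 1, 3)]
    triples fill [q - 1] classes ([triples_cover]), with exactly
    ['C(q + 1, 2) / 3] triples on average.  So every class would be a Steiner
    triple system on [q + 1] points, and [3] would divide ['C(q + 1, 2)]; this
    fails when [q] is [1] modulo [3] ([triple_count_lt]).

    The maximum [M] itself exists because lengths are bounded in this way and
    the full space is an MDS code of length [q - 1].  *)

(** * Packings *)

(** Each [t]-subset of [U] lies in at most one block, and each block contains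
    ['C(s, t)] of them. *)
Lemma packing_bound (I : finType) (U : {set I}) (F : {set {set I}}) (s t : nat) :
    (forall T, T \in F -> T \subset U /\ #|T| = s) ->
    (forall T T', T \in F -> T' \in F -> t <= #|T :&: T'| -> T = T') ->
  #|F| * 'C(s, t) <= 'C(#|U|, t).
Proof.
move=> F_blocks F_meet.
pose X := [set P : {set I} | P \subset U & #|P| == t].
have -> : #|F| * 'C(s, t) = \sum_(T in F) \sum_(P in X) (P \subset T).
  rewrite -sum_nat_const; apply: eq_bigr => T /F_blocks [TU <-].
  rewrite -cards_draws -sum1dep_card big_mkcond [RHS]big_mkcond.
  apply: eq_bigr => P _; rewrite !inE.
  case: (boolP (P \subset T)) => PT /=; last by case: ifP.
  by rewrite (subset_trans PT TU).
rewrite exchange_big /= -cards_draws -/X -sum1_card.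
apply: leq_sum => P; rewrite inE => /andP [_ /eqP cP].
rewrite -big_mkcondr sum1dep_card /=; apply/card_le1_eqP => T T'.
rewrite !inE => /andP [TF PT] /andP [T'F PT'].
by apply: F_meet => //; rewrite -cP subset_leq_card // subsetI PT PT'.
Qed.

(** * MDS codes *)

Lemma MDS_eq_on (A : finType) (n k : nat) (C : {set {ffun 'I_n -> A}})
    (K : {set 'I_n}) (x y : {ffun 'I_n -> A}) :
  is_MDS k C -> x \in C -> y \in C -> k <= #|K| -> {in K, x =1 y} -> x = y.
Proof.
move=> [_ [_ dC]] xC yC kK xy; apply/eqP/negPn/negP => x_neq_y.
have := dC x y xC yC x_neq_y; rewrite leqNgt => /negP; apply.
rewrite addn1 ltnS (leq_trans _ (leq_sub2l n kK)) //.
have -> : n - #|K| = #|~: K| by rewrite -[n in n - _]card_ord -(cardsC K) addKn.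
apply: subset_leq_card; apply/subsetP => u; rewrite !inE.
by apply: contraNN => uK; rewrite xy.
Qed.

(** The restriction of [C] to [K] is injective, and [C] has exactly as many
    words as there are functions on [K]. *)
Lemma MDS_interpolation (A : finType) (n k : nat) (C : {set {ffun 'I_n -> A}})
    (K : {set 'I_n}) (f : 'I_n -> A) :
  is_MDS k C -> #|K| = k -> exists2 x, x \in C & {in K, x =1 f}.
Proof.
move=> C_MDS cK.
pose res (x : 'I_n -> A) := [ffun u : {u | u \in K} => x (val u)].
pose h (x : {ffun 'I_n -> A}) := res x.
have h_inj : {in C &, injective h}.
  move=> x y xC yC /ffunP hxy; apply: (@MDS_eq_on _ _ _ _ K _ _ C_MDS) => //.
    by rewrite cK.
  by move=> u uK; have := hxy (exist _ u uK); rewrite !ffunE.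
have h_onto : h @: C = [set: {ffun {u | u \in K} -> A}].
  apply/eqP; rewrite eqEcard subsetT cardsT card_in_imset //.
  by rewrite card_ffun card_sig; case: C_MDS => -> _; rewrite -cK leqnn.
have : res f \in h @: C by rewrite h_onto inE.
case/imsetP => x xC /ffunP fx; exists x => // u uK.
by have := fx (exist _ u uK); rewrite !ffunE.
Qed.

Lemma full_code_MDS (A : finType) (k : nat) :
  0 < k -> 1 < #|A| -> MDS_exists A k k.
Proof.
case: k => // k _ /card_gt1P [a [b [_ _ a_neq_b]]].
exists setT; split; first by rewrite cardsT card_ffun card_ord.
rewrite subnn add0n; split=> [|x y _ _ x_neq_y].
  (* Two words that differ in the first coordinate only. *)
  exists [ffun=> a], [ffun i => if i == ord0 then b else a]; split=> //.
    by apply: contraNneq a_neq_b => /ffunP /(_ ord0); rewrite !ffunE eqxx => ->.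
  rewrite /hamming_dist (_ : [set _ | _] = [set ord0]) ?cards1 //.
  by apply/setP => i; rewrite !inE !ffunE; case: (i == ord0); rewrite ?eqxx.
rewrite card_gt0; apply: contraNneq x_neq_y => /setP xy; apply/eqP/ffunP => i.
by apply/eqP/negPn; have := xy i; rewrite !inE => ->.
Qed.

(** The search for a code of length [n] is finite, so the largest length is
    obtained from an upper bound without classical logic. *)
Lemma MDS_exists_dec (A : finType) (k n : nat) : decidable (MDS_exists A k n).
Proof.
pose N := #|A| ^ k; pose d := n - k + 1.
apply: (@decP _ [exists C : {set {ffun 'I_n -> A}}, [&& #|C| == N,
  [exists x, exists y, [&& x \in C, y \in C, x != y & hamming_dist x y == d]] &
  [forall x in C, forall y in C, (x != y) ==> (d <= hamming_dist x y)]]]).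
apply: (iffP existsP) => -[C].
  case/and3P => /eqP cC /existsP [x /existsP [y /and4P [xC yC xy /eqP dxy]]].
  move=> /forall_inP dC; exists C; split=> //; split; first by exists x, y.
  by move=> u v uC vC uv; move/forall_inP: (dC u uC) => /(_ v vC) /implyP; apply.
case=> cC [[x [y [xC yC xy dxy]]] dC]; exists C; apply/and3P; split.
- exact/eqP.
- by apply/existsP; exists x; apply/existsP; exists y; rewrite xC yC xy dxy /=.
- apply/forall_inP => u uC; apply/forall_inP => v vC; apply/implyP => uv.
  exact: dC.
Qed.

Lemma bounded_maximum (P : nat -> Prop) (n0 m : nat) :
    (forall n, decidable (P n)) -> P n0 -> (forall n, P n -> n <= m) ->
  exists M, P M /\ (forall n, P n -> n <= M).
Proof.
move=> P_dec Pn0 P_le.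
pose p n : bool := P_dec n.
have exp : exists n, p n by exists n0; apply/sumboolP.
have p_le n : p n -> n <= m by move=> /sumboolP; apply: P_le.
case: (ex_maxnP exp p_le) => M /sumboolP PM M_max; exists M; split=> // n Pn.
by apply: M_max; apply/sumboolP.
Qed.

(** * Triple systems carried by an MDS code *)

(** The triples are defined by the existence of a word rather than as images of
    words, so that no word needs to be chosen for a triple. *)
Definition triples {A : finType} {n : nat} (C : {set {ffun 'I_n -> A}})
    (c : {ffun 'I_n -> A}) (U : {set 'I_n}) (i j : 'I_n) (a b : A) :
    {set {set 'I_n}} :=
  [set T : {set 'I_n} | [&& T \subset U, #|T| == 3 &
    [exists x in C, [&& x i == a, x j == b &
      [forall u in U, (x u != c u) == (u \in T)]]]]].

(** Two triples of one class with two common points come from words that agree at [i], at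
    [j] and on at least [#|A| - 3] points of [U], hence from the same word. *)
Lemma triples_packing (A : finType) (n : nat) (C : {set {ffun 'I_n -> A}})
    (c : {ffun 'I_n -> A}) (U : {set 'I_n}) (i j : 'I_n) (a b : A) :
    is_MDS (#|A| - 1) C -> i != j -> i \notin U -> j \notin U ->
    #|U| = #|A| + 1 ->
  #|triples C c U i j a b| * 3 <= 'C(#|A| + 1, 2).
Proof.
move=> C_MDS i_neq_j iU jU cU; rewrite -cU -[3]/('C(3, 2)).
apply: packing_bound => [T | T T'].
  by rewrite inE => /and3P [TU /eqP cT _].
rewrite !inE => /and3P [TU /eqP cT /exists_inP [x xC]].
case/and3P => /eqP xi /eqP xj /forall_inP xT.
case/and3P => [T'U /eqP cT' /exists_inP [y yC]].
case/and3P => /eqP yi /eqP yj /forall_inP yT' TT'.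
suff xy : x = y.
  apply/setP => u; apply/idP/idP => uT.
    have uU := subsetP TU u uT.
    by rewrite -(eqP (yT' u uU)) -xy (eqP (xT u uU)).
  have uU := subsetP T'U u uT.
  by rewrite -(eqP (xT u uU)) xy (eqP (yT' u uU)).
apply: (@MDS_eq_on _ _ _ _ (i |: (j |: (U :\: (T :|: T')))) _ _ C_MDS) => //.
  rewrite !cardsU1 !inE (negPf i_neq_j) (negPf iU) (negPf jU) !andbF /=.
  rewrite cardsD (setIidPr _) ?subUset ?TU // cU cardsU cT cT'.
  by move: TT'; move: #|T :&: T'| #|A| => t m; lia.
move=> u; rewrite !inE => /or3P [/eqP -> | /eqP -> |].
- by rewrite xi yi.
- by rewrite xj yj.
case/andP => /norP [uT uT'] uU.
have /negPn/eqP -> : ~~ (x u != c u) by rewrite (eqP (xT u uU)).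
by apply/esym/eqP/negPn; rewrite (eqP (yT' u uU)).
Qed.

(** Prescribing [x i = a] and [x = c] on [U :\: T] uses [#|A| - 1] coordinates,
    so it is possible; and as [x] is not [c], it cannot agree with [c] in any
    coordinate beyond [U :\: T]. *)
Lemma triples_cover (A : finType) (n : nat) (C : {set {ffun 'I_n -> A}})
    (c : {ffun 'I_n -> A}) (U : {set 'I_n}) (i j : 'I_n) (a : A) :
    is_MDS (#|A| - 1) C -> c \in C -> a != c i -> i != j ->
    i \notin U -> j \notin U -> 1 < #|A| -> #|U| = #|A| + 1 ->
  [set T : {set 'I_n} | T \subset U & #|T| == 3] \subset
    \bigcup_(b in [set~ c j]) triples C c U i j a b.
Proof.
move=> C_MDS cC aci i_neq_j iU jU A_gt1 cU; apply/subsetP => T.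
rewrite inE => /andP [TU cT].
have cUT : (#|U :\: T|).+1 = #|A| - 1.
  by rewrite cardsD (setIidPr TU) (eqP cT) cU; lia.
have [x xC xf] : exists2 x, x \in C &
    {in i |: (U :\: T), x =1 fun u => if u == i then a else c u}.
  apply: (MDS_interpolation _ _ _ _ _ _ C_MDS).
  by rewrite cardsU1 !inE (negPf iU) andbF /= add1n.
have xi : x i = a by rewrite xf ?eqxx // !inE eqxx.
have x_neq_c : x != c by apply: contraNneq aci => <-; rewrite xi.
have xUT : {in U :\: T, x =1 c}.
  move=> u uUT; rewrite xf ?inE; last by rewrite -in_setD uUT orbT.
  by case: eqP => // ui; move: uUT; rewrite ui inE (negPf iU) andbF.
have xc v : v \notin U :\: T -> x v != c v.
  move=> vUT; apply: contraNneq x_neq_c => xv; apply/eqP.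
  apply: (@MDS_eq_on _ _ _ _ (v |: (U :\: T)) _ _ C_MDS) => //.
    by rewrite cardsU1 vUT -cUT.
  by move=> u /setU1P [-> | /xUT].
apply/bigcupP; exists (x j); first by rewrite !inE xc // inE (negPf jU) andbF.
rewrite inE TU cT; apply/exists_inP; exists x => //; rewrite xi !eqxx /=.
apply/forall_inP => u uU; case: (boolP (u \in T)) => uT.
  by rewrite xc // inE uT.
by rewrite xUT ?eqxx // inE uT.
Qed.

(** * The length bound *)

(** Without the floor both sides would be equal; it makes the left side smaller
    because [3] does not divide ['C(q + 1, 2)]. *)
Lemma triple_count_lt (q : nat) : 1 < q -> q %% 3 = 1 ->
  (q - 1) * ('C(q + 1, 2) %/ 3) < 'C(q + 1, 3).
Proof.
move=> q_gt1 q_mod3.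
have bin_q2 : 2 * 'C(q + 1, 2) = q * (q + 1).
  by have := mul_bin_left (q + 1) 1; rewrite bin1 addnK.
have bin_q3 : 3 * 'C(q + 1, 3) = (q - 1) * 'C(q + 1, 2).
  by have := mul_bin_left (q + 1) 2; rewrite addn1 subSS.
have ndvd : ~~ (3 %| 'C(q + 1, 2)).
  apply: (contraNN (@dvdn_mull 3 2 _)); rewrite bin_q2.
  by rewrite /dvdn -modnMm -modnDml q_mod3.
rewrite -(ltn_pmul2l (m := 3)) // bin_q3 mulnCA ltn_pmul2l ?subn_gt0 //.
by rewrite mulnC ltn_neqAle leq_divM andbT -dvdn_eq.
Qed.

Lemma MDS_length_bound (A : finType) (n : nat) :
  1 < #|A| -> #|A| %% 3 = 1 -> MDS_exists A (#|A| - 1) n -> n <= #|A| + 2.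
Proof.
move=> A_gt1 A_mod3 [C C_MDS]; rewrite leqNgt; apply/negP => n_gt.
have /card_gt0P [c cC] : 0 < #|C| by case: C_MDS => -> _; rewrite expn_gt0 ltnW.
have := n_gt; rewrite -{1}[n]card_ord.
case/card_geqP => -[|i [|j s]] [s_uniq]; rewrite ?addn2 //= => -[s_size] _.
move: s_uniq; rewrite /= inE negb_or.
case/and3P => /andP [i_neq_j i_s] j_s s_uniq.
pose U := [set u in s].
have iU : i \notin U by rewrite inE.
have jU : j \notin U by rewrite inE.
have cU : #|U| = #|A| + 1.
  by rewrite cardsE (card_uniqP s_uniq) s_size addn1.
have /card_gt0P [a] : 0 < #|[set~ c i]|.
  by rewrite cardsC1 -subn1 subn_gt0.
rewrite !inE => a_neq_ci.
have := subset_leq_card (triples_cover _ _ _ _ _ _ _ _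
  C_MDS cC a_neq_ci i_neq_j iU jU A_gt1 cU).
rewrite cards_draws cU leqNgt => /negP; apply.
(* The [#|A| - 1] classes are too small to hold all triples of [U]. *)
apply: leq_ltn_trans (triple_count_lt _ A_gt1 A_mod3).
rewrite subn1 -(cardsC1 (c j)) -sum_nat_const.
apply: (@leq_trans (\sum_(b in [set~ c j]) #|triples C c U i j a b|)).
  apply: (big_ind2 (fun (X : {set _}) m => #|X| <= m)); rewrite ?cards0 //.
  by move=> X m Y p Xm Yp; rewrite (leq_trans (leq_card_setU X Y)) ?leq_add.
apply: leq_sum => b _; rewrite leq_divRL //.
exact: triples_packing.
Qed.

Theorem theorem2p1 (q : nat) (A : finType) (q_gt0 : 0 < q)
    (q_mod6 : q = 4 %[mod 6]) (card_A : #|A| = q) :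
  exists M : nat, max_MDS_length_is A (q - 1) M /\ M <= q + 2.
Proof.
have q_mod3 : q %% 3 = 1 by rewrite -(@modn_dvdm 6) // q_mod6.
have q_gt1 : 1 < q by case: q q_gt0 q_mod6 {card_A q_mod3} => [|[|]].
subst q.
have [M [M_MDS M_max]] : exists M, max_MDS_length_is A (#|A| - 1) M.
  apply: (bounded_maximum _ (#|A| - 1) (#|A| + 2)).
  - exact: MDS_exists_dec.
  - by apply: full_code_MDS; rewrite ?subn_gt0.
  - by move=> n; apply: MDS_length_bound.
by exists M; split; [split | apply: MDS_length_bound].
Qed.
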